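(* For all positive integers $n,d$, one has $\operatorname{sxdeg}(C_{n,2d}) = 2$.
   Context: $\mathbb{R}[\mathbf{x}]_{2d}$ is the vector space of real polynomials in variables $\mathbf{x}=(x_1,\ldots,x_n)$ of degree at most $2d$. $\mathbb{Z}_+$ is the set of non-negative integers; for $\alpha\in\mathbb{Z}_+^n$, $\mathbf{x}^\alpha = x_1^{\alpha_1}\cdots x_n^{\alpha_n}$ and $|\alpha|=\alpha_1+\cdots+\alpha_n$. Let $\mathcal{A}_n$ be the set of all $A\subseteq\mathbb{Z}_+^n$ of the form $A=\{\alpha(0),\ldots,\alpha(k),\beta\}$ with $k\in\{1,\ldots,n\}$ such that: (1) $\alpha(0),\ldots,\alpha(k)\in(2\mathbb{Z}_+)^n$; (2) $\alpha(0),\ldots,\alpha(k)$ are the vertices of a $k$-dimensional simplex; (3) $\beta$ lies in the relative interior of that simplex, i.e. $\beta=\sum_{i=0}^k\lambda_i\alpha(i)$ with (uniquely determined) $\lambda_i>0$, $\sum_{i=0}^k\lambda_i=1$. Let $\mathcal{A}_{n,2d}:=\{A\in\mathcal{A}_n : |\alpha|\le 2d \text{ for all }\alpha\in A\}$. For $A=\{\alpha(0),\ldots,\alpha(k),\beta\}\in\mathcal{A}_n$, where $\alpha(0),\ldots,\alpha(k)\in(2\mathbb{Z}_+)^n$ are the vertices of a $k$-dimensional simplex with $k\in\{1,\ldots,n\}$ and $\beta$ lies in the relative interior of that simplex, the set of non-negative circuit polynomials with respect to $A$ is $$\tilde P_{n,A}:=\Big\{f=\sum_{\alpha\in A}f_\alpha\mathbf{x}^\alpha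 : f\ge 0\text{ on }\mathbb{R}^n,\ f_{\alpha(0)}>0,\ldots,f_{\alpha(k)}>0\Big\}.$$ The SONC cone $C_{n,2d}$ is the set of all $f\in\mathbb{R}[\mathbf{x}]_{2d}$ that can be written as $f=\mu_1f_1+\cdots+\mu_Nf_N$ with $N$ a positive integer, $\mu_1,\ldots,\mu_N\ge 0$, and each $f_i$ either an element of $\tilde P_{n,A}$ for some $A\in\mathcal{A}_{n,2d}$ or a monomial square $f_i=\mathbf{x}^{2\alpha}$ with $\alpha\in\mathbb{Z}_+^n$, $|\alpha|\le d$. $\mathcal{S}^j$ is the vector space of real symmetric $j\times j$ matrices and $\mathcal{S}_+^j\subseteq \mathcal{S}^j$ is the cone of positive semidefinite ones. For a closed convex cone $K$ in a finite-dimensional real vector space $E$, a subset $S$ of a real vector space $V$ has a $K$-lift if $S = \pi(K \cap H)$ for some affine subspace $H$ of $E$ and some linear map $\pi: E \to V$. The semidefinite extension degree $\operatorname{sxdeg}(S)$ is the smallest positive integer $j$ such that $S$ has an $(\mathcal{S}_+^j)^m$-lift for some finite positive integer $m$, where $(\mathcal{S}_+^j)^m = \mathcal{S}_+^j\times\cdots\times\mathcal{S}_+^j$ ($m$ factors); $\operatorname{sxdeg}(S):=\infty$ if there is no such $j$. *)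

(* Defs.v *)
From mathcomp Require Import all_boot all_order all_algebra.
From mathcomp Require Import mpoly.
From mathcomp Require Import boolp classical_sets reals constructive_ereal.

Set Implicit Arguments.
Unset Strict Implicit.
Unset Printing Implicit Defensive.

Import Order.TTheory GRing.Theory Num.Theory.
Local Open Scope classical_set_scope.
Local Open Scope ring_scope.

Section SONC.
Variables (R : realType) (n : nat).
Implicit Types (k d : nat) (A : set 'X_{1..n}) (f : {mpoly R[n]}).

Definition mnm_point (m : 'X_{1..n}) : 'rV[R]_n := \row_i (m i)%:R.

(* That is, the p i are the vertices of a k-dimensional simplex. *)
Definition affinely_independent k (p : 'I_k.+1 -> 'rV[R]_n) : Prop :=
  free [seq p (lift ord0 i) - p ord0 | i : 'I_k].

Definition in_open_simplex k (p : 'I_k.+1 -> 'rV[R]_n) (q : 'rV[R]_n) : Prop :=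
  exists lam : 'I_k.+1 -> R,
    [/\ forall i, 0 < lam i, \sum_i lam i = 1 & q = \sum_i lam i *: p i].

(* [A] = {alpha 0, ..., alpha k, beta}.  The alpha i are the extreme points of
   the convex hull of A, so A determines (alpha, beta) up to the order of the
   alpha i. *)
Definition is_circuit A k (alpha : 'I_k.+1 -> 'X_{1..n})
    (beta : 'X_{1..n}) : Prop :=
  [/\ A = range alpha `|` [set beta],
      (1 <= k <= n)%N,
      forall i j, ~~ odd (alpha i j),
      affinely_independent (mnm_point \o alpha) &
      in_open_simplex (mnm_point \o alpha) (mnm_point beta)].

Definition circuits : set (set 'X_{1..n}) :=
  [set A | exists k (alpha : 'I_k.+1 -> 'X_{1..n}) beta,
             is_circuit A alpha beta].

Definition circuits_deg d : set (set 'X_{1..n}) :=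
  [set A | circuits A /\ forall a, A a -> (mdeg a <= d)%N].

Definition mpoly_nonneg f : Prop := forall x : 'I_n -> R, 0 <= f.@[x].

Definition nonneg_circuit_polys A : set {mpoly R[n]} :=
  [set f | exists k (alpha : 'I_k.+1 -> 'X_{1..n}) beta,
     [/\ is_circuit A alpha beta,
         f = \sum_i f@_(alpha i) *: 'X_[alpha i] + f@_beta *: 'X_[beta],
         mpoly_nonneg f &
         forall i, 0 < f@_(alpha i)]].

(* [msize f] is the degree of f plus one, and 0 for f = 0. *)
Definition SONC d : set {mpoly R[n]} :=
  [set f | (msize f <= (2 * d).+1)%N /\
     exists N (mu : 'I_N -> R) (g : 'I_N -> {mpoly R[n]}),
       [/\ (0 < N)%N,
           forall i, 0 <= mu i,
           forall i,
             (exists2 A, circuits_deg (2 * d) A & nonneg_circuit_polys A (g i))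
             \/ (exists2 a : 'X_{1..n}, (mdeg a <= d)%N & g i = 'X_[a *+ 2]) &
           f = \sum_i mu i *: g i]].

End SONC.

Arguments SONC R n d : clear implicits.

Section Lifts.
Variable R : realType.

Definition affine_subspace (E : vectType R) (H : set E) : Prop :=
  exists (p : E) (U : {vspace E}), H = [set p + u | u in [set u | u \in U]].

(* Only meaningful for K a closed convex cone; [psd_pow] is one. *)
Definition has_lift (E : vectType R) (K : set E) (V : lmodType R)
    (S : set V) : Prop :=
  exists (H : set E) (pi : {linear E -> V}),
    affine_subspace H /\ S = pi @` (K `&` H).

Definition sym_mx j : {vspace 'M[R]_j} := fixedSpace (linfun trmx).

Definition psd j : set (subvs_of (sym_mx j)) :=
  [set M | forall x : 'cV[R]_j, 0 <= (x^T *m vsval M *m x) 0 0].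

Definition psd_pow j m : set {ffun 'I_m -> subvs_of (sym_mx j)} :=
  [set M | forall i, psd (M i)].

Definition has_psd_lift (V : lmodType R) (S : set V) (j : nat) : Prop :=
  (0 < j)%N /\ exists2 m, (0 < m)%N & has_lift (@psd_pow j m) S.

Definition sxdeg (V : lmodType R) (S : set V) : \bar nat :=
  match pselect (exists j, `[< has_psd_lift S j >]) with
  | left hS => (ex_minn hS)%:E
  | right _ => +oo%E
  end.

End Lifts.

(* Main.v *)
From HB Require Import structures.
Require Import Defs.
From mathcomp Require Import all_boot all_order all_algebra.
From mathcomp Require Import mpoly.
From mathcomp Require Import boolp classical_sets reals constructive_ereal.
From mathcomp Require sequences exp.
From mathcomp Require Import ring lra.

Set Implicit Arguments.
Unset Strict Implicit.
Unset Printing Implicit Defensive.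

Import Order.TTheory GRing.Theory Num.Theory.
Local Open Scope classical_set_scope.
Local Open Scope ring_scope.

(** Two things have to be shown: the SONC cone has a lift built from 2x2
    positive semidefinite blocks, and it has none built from 1x1 blocks, which
    would make it a projection of a polyhedron.

    Upper bound.  A 2x2 block [[a, b], [b, c]] is positive semidefinite iff
    a, c >= 0 and b^2 <= a c, so a lift by 2x2 blocks is a description by
    finitely many such inequalities between linear functionals, with auxiliary
    variables projected away.  Cones described in this way ([soc_cone]) are
    closed under Minkowski sums, and the SONC cone is a sum over the finitely
    many circuits and monomial squares of bounded degree; so a single circuit
    suffices.  There the barycentric coordinates of the inner exponent beta are
    rational, because the exponents are integers and the alpha i are affinely
    independent.  Clearing denominators gives q beta = sum_i p_i alpha_i with
    positive integers p_i of sum q.  By the weighted inequality between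
    arithmetic and geometric means, nonnegativity of
    sum_i c_i x^alpha_i + b x^beta follows from
    |b|^q <= prod_i (q c_i / p_i)^p_i ([circuit_poly_nonneg]).  Conversely,
    affine independence lets one choose, by solving a linear system in the
    logarithms of the coordinates, a point where all c_i x^alpha_i / p_i are
    equal; the inequality of means is an equality there, so the bound is
    necessary unless b x^beta is itself a nonnegative multiple of a monomial
    square ([circuit_poly_nonneg_cone]).  The bound says that |b| is at most a
    geometric mean of q linear forms.  After padding the q forms with copies of
    the mean itself their number is a power of two, and then the mean is
    computed by a binary tree whose nodes are inequalities t^2 <= u w
    ([soc_rep_gm]).

    Lower bound.  The polynomials (x_0 - t)^2, t = 1, 2, ..., are all in the
    cone.  If it were the linear image of an affine slice of an orthant, two of
    them, for parameters s and t, would have preimages with the same support.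
    The segment between these preimages could then be prolonged a little within
    the slice, so that (1 + eps) (x_0 - t)^2 - eps (x_0 - s)^2 would be in the
    cone; but this is negative at x_0 = t. *)

(** * Cones described by rotated second-order cone inequalities *)

Section Soc.
Variable R : realType.

Definition lpair (U V W : lmodType R) (f : {linear U -> V})
  (g : {linear U -> W}) (u : U) : (V * W)%type := (f u, g u).

Lemma lpair_linear (U V W : lmodType R) (f : {linear U -> V})
  (g : {linear U -> W}) : linear (lpair f g).
Proof. by move=> a u v; rewrite /lpair !linearP. Qed.

HB.instance Definition _ (U V W : lmodType R) (f : {linear U -> V})
  (g : {linear U -> W}) :=
  GRing.isLinear.Build R U (V * W)%type *:%R (lpair f g) (lpair_linear f g).

Definition lscale (U V : lmodType R) (l : {scalar U}) (g : V) (u : U) : V :=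
  l u *: g.

Lemma lscale_linear (U V : lmodType R) (l : {scalar U}) (g : V) :
  linear (lscale l g).
Proof. by move=> a u v; rewrite /lscale linearP scalerDl scalerA. Qed.

HB.instance Definition _ (U V : lmodType R) (l : {scalar U}) (g : V) :=
  GRing.isLinear.Build R U V *:%R (lscale l g) (lscale_linear l g).

(** The functionals (a, b, c) of a symmetric block [[a, b], [b, c]]. *)
Definition rsoc_form (V : lmodType R) :=
  ({scalar V} * {scalar V} * {scalar V})%type.

Definition rsoc (V : lmodType R) (v : V) (t : rsoc_form V) : bool :=
  [&& 0 <= t.1.1 v, 0 <= t.2 v & t.1.2 v ^+ 2 <= t.1.1 v * t.2 v].

Definition rsoc_pull (U V : lmodType R) (f : {linear U -> V})
    (t : rsoc_form V) : rsoc_form U :=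
  (t.1.1 \o f : {scalar U}, t.1.2 \o f : {scalar U}, t.2 \o f : {scalar U}).

Lemma all_rsoc_pull (U V : lmodType R) (f : {linear U -> V})
    (s : seq (rsoc_form V)) u :
  all (rsoc u) (map (rsoc_pull f) s) = all (rsoc (f u)) s.
Proof. by rewrite all_map; apply: eq_all. Qed.

(** The second factor of [V * W] holds the auxiliary variables of the
    description; it is kept apart from [V] so that intersections can share
    the variables of [V]. *)
Definition soc_rep (V : lmodType R) (S : set V) : Prop :=
  exists (W : vectType R) (s : seq (rsoc_form (V * W)%type)),
    S = [set v | exists w, all (rsoc (v, w)) s].

Definition soc_cone (V : lmodType R) (S : set V) : Prop :=
  exists (W : vectType R) (s : seq (rsoc_form W)) (pi : {linear W -> V}),
    S = pi @` [set w | all (rsoc w) s].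

Lemma soc_rep_rsoc (V : lmodType R) (a b c : {scalar V}) :
  soc_rep [set v | [/\ 0 <= a v, 0 <= c v & b v ^+ 2 <= a v * c v]].
Proof.
exists ('rV[R]_0), [:: rsoc_pull (@fst V 'rV[R]_0) (a, b, c)].
apply/seteqP; split=> v /=.
  by case=> ha hc hb; exists 0; rewrite andbT; apply/and3P.
by case=> w; rewrite andbT => /and3P[].
Qed.

Lemma soc_rep_ge0 (V : lmodType R) (a : {scalar V}) :
  soc_rep [set v | 0 <= a v].
Proof.
have := soc_rep_rsoc a a a; congr soc_rep.
by apply/seteqP; split=> v /= => [[] //|ha]; rewrite expr2.
Qed.

Lemma soc_repI (V : lmodType R) (S T : set V) :
  soc_rep S -> soc_rep T -> soc_rep (S `&` T).
Proof.
move=> [W [s ->]] [X [t ->]].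
pose p := lpair (@fst V (W * X)%type) (@fst W X \o @snd V (W * X)%type).
pose q := lpair (@fst V (W * X)%type) (@snd W X \o @snd V (W * X)%type).
exists (W * X)%type, (map (rsoc_pull p) s ++ map (rsoc_pull q) t).
apply/seteqP; split=> v /=.
  by case=> -[w sw] [x tx]; exists (w, x); rewrite all_cat !all_rsoc_pull sw.
case=> -[w x]; rewrite all_cat !all_rsoc_pull => /andP[sw tx].
by split; [exists w | exists x].
Qed.

Lemma soc_rep_proj (V : lmodType R) (X : vectType R) (S : set (V * X)%type) :
  soc_rep S -> soc_rep [set v | exists x, S (v, x)].
Proof.
move=> [W [s ->]].
pose p := lpair (lpair (@fst V (X * W)%type) (@fst X W \o @snd V (X * W)%type))
  (@snd X W \o @snd V (X * W)%type).
exists (X * W)%type, (map (rsoc_pull p) s).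
apply/seteqP; split=> v /=.
  by case=> x [w sw]; exists (x, w); rewrite all_rsoc_pull.
by case=> -[x w]; rewrite all_rsoc_pull => sw; exists x, w.
Qed.

Lemma exists_root2X (m : nat) (a : R) : 0 <= a ->
  exists2 u, 0 <= u & u ^+ (2 ^ m) = a.
Proof.
elim: m a => [|m IH] a a0; first by exists a; rewrite ?expr1.
have [u u0 ua] := IH _ (sqrtr_ge0 a).
by exists u => //; rewrite expnSr exprM ua sqr_sqrtr.
Qed.

Definition gm_set (V : lmodType R) (e : nat) (tau : {scalar V})
  (ls : seq {scalar V}) : set V :=
  [set v | [/\ 0 <= tau v, all (fun l : {scalar V} => 0 <= l v) ls &
     tau v ^+ e <= \prod_(l <- ls) l v]].

Lemma prod_scalar_ge0 (V : lmodType R) (ls : seq {scalar V}) (v : V) :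
  all (fun l : {scalar V} => 0 <= l v) ls -> 0 <= \prod_(l <- ls) l v.
Proof.
elim: ls => [|l s IHs] /=; rewrite ?big_nil ?big_cons ?ler01 // => /andP[? ?].
by rewrite mulr_ge0 // IHs.
Qed.

(** A geometric mean of [2 ^ m.+1] numbers is the geometric mean of the means
    [u] and [w] of the two halves, so that one more block, for
    [tau ^ 2 <= u * w], is enough to pass from [m] to [m.+1]. *)
Lemma soc_rep_gm2X (m : nat) (V : lmodType R) (tau : {scalar V})
    (ls : seq {scalar V}) :
  size ls = (2 ^ m)%N -> soc_rep (gm_set (2 ^ m) tau ls).
Proof.
elim: m V tau ls => [|m IH] V tau ls.
  case: ls => [|l []] //= _.
  have := soc_repI (soc_rep_ge0 tau) (soc_rep_ge0 (l \- tau : {scalar V})).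
  congr soc_rep; apply/seteqP; split=> v /=; rewrite /gm_set /= big_seq1 expr1.
    by rewrite subr_ge0 andbT => -[h1 h2]; split=> //; apply: le_trans h2.
  by rewrite subr_ge0 => -[].
move=> szls.
pose U := (V * R^o * R^o)%type.
pose pv : {linear U -> V} := @fst V R^o \o @fst (V * R^o)%type R^o.
pose pu : {scalar U} := @snd V R^o \o @fst (V * R^o)%type R^o.
pose pw : {scalar U} := @snd (V * R^o)%type R^o.
pose lift (l : {scalar V}) : {scalar U} := l \o pv.
have pow2S : (2 ^ m.+1 = 2 ^ m + 2 ^ m)%N by rewrite expnS mul2n addnn.
have sz1 : size (map lift (take (2 ^ m) ls)) = (2 ^ m)%N.
  by rewrite size_map size_takel // szls pow2S leq_addr.
have sz2 : size (map lift (drop (2 ^ m) ls)) = (2 ^ m)%N.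
  by rewrite size_map size_drop szls pow2S addKn.
have := soc_rep_proj (soc_rep_proj (soc_repI (soc_repI (IH U pu _ sz1)
  (IH U pw _ sz2)) (soc_repI (soc_rep_ge0 (lift tau))
  (soc_rep_rsoc pu (lift tau) pw)))).
congr soc_rep; apply/seteqP; split=> v /=.
  case=> u [w [[]]]; rewrite /gm_set /= !all_map !big_map /= => -[u0 h1 g1].
  move=> [w0 h2 g2] [t0 [_ _ tuw]]; split=> //.
    by rewrite -(cat_take_drop (2 ^ m) ls) all_cat h1.
  rewrite -{1}(cat_take_drop (2 ^ m) ls) big_cat /= expnS exprM.
  apply: (le_trans (y := (u * w) ^+ (2 ^ m))).
    by rewrite lerXn2r // ?nnegrE ?sqr_ge0 ?mulr_ge0.
  by rewrite exprMn ler_pM ?exprn_ge0.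
rewrite /gm_set /= -{1 2}(cat_take_drop (2 ^ m) ls) all_cat big_cat /=.
case=> t0 /andP[h1 h2] g.
have [u u0 ua] := exists_root2X m (prod_scalar_ge0 h1).
have [w w0 wa] := exists_root2X m (prod_scalar_ge0 h2).
exists u, w; rewrite !all_map !big_map /=.
have tuw : tau v ^+ 2 <= u * w.
  rewrite -(@ler_pXn2r _ (2 ^ m)) ?nnegrE ?sqr_ge0 ?mulr_ge0 ?expn_gt0 //.
  by rewrite -exprM -expnS exprMn ua wa.
split; first by split; split=> //=; rewrite ?ua ?wa.
by split=> //; split.
Qed.

(** With [e = 2 ^ q - q] copies of [tau] added to the list, the inequality
    becomes [tau ^ (2 ^ q) <= (\prod l) * tau ^ e], from which [tau ^ e]
    cancels when [tau] is not zero. *)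
Lemma soc_rep_gm (V : lmodType R) (tau : {scalar V}) (ls : seq {scalar V}) :
  soc_rep (gm_set (size ls) tau ls).
Proof.
set q := size ls.
have qle : (q <= 2 ^ q)%N by rewrite ltnW // ltn_expl.
have szp : size (ls ++ nseq (2 ^ q - q) tau) = (2 ^ q)%N.
  by rewrite size_cat size_nseq subnKC.
have := soc_rep_gm2X tau szp; congr soc_rep.
have prE v : \prod_(l <- ls ++ nseq (2 ^ q - q) tau) l v
    = (\prod_(l <- ls) l v) * tau v ^+ (2 ^ q - q).
  by rewrite big_cat big_nseq /= iter_mulr mulr1.
have qE v : tau v ^+ (2 ^ q) = tau v ^+ q * tau v ^+ (2 ^ q - q).
  by rewrite -exprD subnKC.
apply/seteqP; split=> v; rewrite /gm_set /= prE qE all_cat all_nseq.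
  case=> t0 /andP[h _] g; split=> //.
  have [t_eq0|t_neq0] := eqVneq (tau v) 0; last first.
    rewrite -(ler_pM2r (x := tau v ^+ (2 ^ q - q))) //.
    by rewrite exprn_gt0 // lt0r t_neq0.
  rewrite t_eq0 expr0n.
  have [q0|_] := eqVneq q 0%N; first by rewrite (size0nil q0) big_nil.
  exact: prod_scalar_ge0.
case=> t0 h g; split=> //; first by rewrite h t0 orbT.
by rewrite ler_wpM2r // exprn_ge0.
Qed.

Lemma soc_rep_image (V : vectType R) (V' : lmodType R) (S : set V)
    (pi : {linear V -> V'}) : soc_rep S -> soc_cone (pi @` S).
Proof.
move=> [W [s ->]]; exists (V * W)%type, s, (pi \o @fst V W).
apply/seteqP; split=> f /=.
  by case=> v [w sw] <-; exists (v, w).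
by case=> -[v w] sw <-; exists v => //; exists w.
Qed.

Section SocCone.
Variable V : lmodType R.
Implicit Types S T : set V.

(** The cross term [2 * b * b'] is bounded by [a * c' + a' * c], because the
    arithmetic mean of [a * c'] and [a' * c] dominates their geometric mean. *)
Lemma rsocD (W : lmodType R) (w x : W) (t : rsoc_form W) :
  rsoc w t -> rsoc x t -> rsoc (w + x) t.
Proof.
rewrite /rsoc !linearD => /and3P[a0 c0 bac] /and3P[a0' c0' bac'].
rewrite !addr_ge0 //=; move: bac bac' a0 c0 a0' c0'.
move: (t.1.1 w) (t.1.2 w) (t.2 w) (t.1.1 x) (t.1.2 x) (t.2 x).
move=> a b c a' b' c' h1 h2 a0 c0 a0' c0'.
have key : b * b' *+ 2 <= a * c' + a' * c.
  have : (b * b' *+ 2) ^+ 2 <= (a * c' + a' * c) ^+ 2.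
    have : b ^+ 2 * b' ^+ 2 <= (a * c) * (a' * c').
      by apply: ler_pM => //; apply: sqr_ge0.
    have := sqr_ge0 (a * c' - a' * c); nra.
  have : 0 <= a * c' + a' * c by rewrite addr_ge0 ?mulr_ge0.
  move: (_ *+ 2) (_ + _) => p q; nra.
nra.
Qed.

Lemma rsocZ (W : lmodType R) (k : R) (w : W) (t : rsoc_form W) :
  0 <= k -> rsoc w t -> rsoc (k *: w) t.
Proof.
move=> k0 /and3P[a0 c0 bac]; rewrite /rsoc !linearZ /= !mulr_ge0 //=.
by rewrite exprMn [leRHS]mulrACA -[k * k]expr2 ler_wpM2l // sqr_ge0.
Qed.

Lemma soc_coneD S f g : soc_cone S -> S f -> S g -> S (f + g).
Proof.
move=> [W [s [pi ->]]] [w /= sw <-] [x /= sx <-].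
exists (w + x); last exact: linearD.
by elim: s sw sx => //= t s IH /andP[? ?] /andP[? ?]; rewrite rsocD ?IH.
Qed.

Lemma soc_coneZ S k f : soc_cone S -> 0 <= k -> S f -> S (k *: f).
Proof.
move=> [W [s [pi ->]]] k0 [w /= sw <-].
exists (k *: w); last exact: linearZ.
by elim: s sw => //= t s IH /andP[? ?]; rewrite rsocZ ?IH.
Qed.

Lemma soc_cone0 S : soc_cone S -> S 0.
Proof.
move=> [W [s [pi ->]]]; exists 0; last exact: linear0.
by elim: s => //= t s ->; rewrite /rsoc !linear0 expr2 mul0r lexx.
Qed.

Definition msum S T : set V := [set f + g | f in S & g in T].

Lemma soc_cone_msum S T : soc_cone S -> soc_cone T -> soc_cone (msum S T).
Proof.
move=> [W [s [p ->]]] [X [t [q ->]]].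
exists (W * X)%type,
  (map (rsoc_pull (@fst W X)) s ++ map (rsoc_pull (@snd W X)) t).
exists ((p \o @fst W X) \+ (q \o @snd W X)).
apply/seteqP; split=> f /=.
  case=> _ [w sw <-] [_ [x tx <-] <-]; exists (w, x) => //=.
  by rewrite all_cat !all_rsoc_pull sw.
case=> -[w x]; rewrite all_cat !all_rsoc_pull /= => /andP[sw tx] <-.
by exists (p w); [exists w | exists (q x); [exists x|]].
Qed.

Lemma soc_cone_set0 : soc_cone [set (0 : V)].
Proof.
exists ('rV[R]_0), [::], \0.
by apply/seteqP; split=> f /= => [->|[w _ <-]] //; exists 0.
Qed.

Lemma soc_cone_ray (g : V) : soc_cone [set c *: g | c in [set c | 0 <= c]].
Proof.
have := @soc_rep_image R^o V _ (lscale (idfun : {scalar R^o}) g)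
  (soc_rep_ge0 (idfun : {scalar R^o})).
by congr soc_cone; apply/seteqP; split=> f /= [c c0 <-]; exists c.
Qed.

(** This reduces the description of a cone to that of finitely many pieces:
    [S] is the Minkowski sum of the [T i].  It is enough that [T i] contains the
    generators of kind [i] and stays in [S]; since second-order cones are
    convex, all conical combinations of generators are in the sum. *)
Lemma soc_cone_cover (I : finType) (S : set V) (G T : I -> set V) :
    S 0 -> (forall f g, S f -> S g -> S (f + g)) ->
    (forall i, [/\ soc_cone (T i), G i `<=` T i & T i `<=` S]) ->
    (forall f, S f -> exists N (mu : 'I_N -> R) (g : 'I_N -> V),
       [/\ forall j, 0 <= mu j, forall j, exists i, G i (g j) &
           f = \sum_j mu j *: g j]) ->
  soc_cone S.
Proof.
move=> S0 SD hT SG.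
pose M (r : seq I) := foldr (fun i => msum (T i)) [set 0] r.
have Mcone r : soc_cone (M r).
  elim: r => [|i r IH] /=; first exact: soc_cone_set0.
  by apply: soc_cone_msum => //; case: (hT i).
suff -> : S = M (index_enum I) by [].
apply/seteqP; split=> f; last first.
  move: (index_enum I) => r; elim: r f => [f -> //|i r IH f /=].
  by case=> g Tg [h Mh <-]; apply: SD; [case: (hT i) => _ _; apply | apply: IH].
move=> /SG[N [mu [g [mu0 gG ->]]]].
apply: big_ind => [|u v|j _]; first exact: soc_cone0.
  exact: soc_coneD.
apply: soc_coneZ => //; have [i /= Gi] := gG j.
have : i \in index_enum I by rewrite mem_index_enum.
have [_ /(_ _ Gi) Ti _] := hT i.
elim: (index_enum I) => //= k r IH; rewrite inE => /predU1P[<-|ir].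
  by exists (g j) => //; exists 0; [exact: soc_cone0|rewrite addr0].
exists 0; first by apply: soc_cone0; case: (hT k).
by exists (g j); [exact: IH | rewrite add0r].
Qed.

End SocCone.
End Soc.

(** * From inequalities to lifts by symmetric 2x2 matrices *)

Section PsdLift.
Variable R : realType.

Definition sym2 (a b c : R) : 'M[R]_2 :=
  \matrix_(i, j) (if (i == 0) && (j == 0) then a
                  else if (i == 0) || (j == 0) then b else c).

Lemma sym2_sym a b c : sym2 a b c \in sym_mx R 2.
Proof.
apply/fixedSpaceP; rewrite lfunE /=.
by apply/matrixP=> i j; rewrite !mxE andbC orbC.
Qed.

Lemma psd_sym2 (M : subvs_of (sym_mx R 2)) (a b c : R) :
  vsval M = sym2 a b c -> psd M <-> [/\ 0 <= a, 0 <= c & b ^+ 2 <= a * c].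
Proof.
move=> ME; rewrite /psd /= ME; clear M ME.
have qE (x : 'cV[R]_2) : (x^T *m sym2 a b c *m x) 0 0
    = a * x 0 0 ^+ 2 + 2 * b * x 0 0 * x 1 0 + c * x 1 0 ^+ 2.
  rewrite !mxE !big_ord_recl big_ord0 !mxE !big_ord_recl !big_ord0 !mxE /=.
  rewrite (_ : lift ord0 ord0 = 1 :> 'I_2); last exact/val_inj.
  ring.
split=> [h|[a0 c0 bac] x]; last first.
  rewrite qE; move: (x 0 0 : R) (x 1 0 : R) => u w.
  have [a_eq0|a_neq0] := eqVneq a 0.
    have b0 : b = 0 by apply/eqP; rewrite -sqrf_eq0; rewrite a_eq0 in bac; nra.
    by rewrite a_eq0 b0; have := mulr_ge0 c0 (sqr_ge0 w); lra.
  have a_gt0 : 0 < a by rewrite lt0r a_neq0.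
  (* a (a u^2 + 2 b u w + c w^2) = (a u + b w)^2 + (a c - b^2) w^2 *)
  rewrite -(pmulr_rge0 _ a_gt0).
  have := sqr_ge0 (a * u + b * w); have := sqr_ge0 w; nra.
pose vec (u w : R) : 'cV[R]_2 := \col_i (if i == 0 then u else w).
have hv u w : 0 <= a * u ^+ 2 + 2 * b * u * w + c * w ^+ 2.
  by have := h (vec u w); rewrite qE !mxE.
have a0 : 0 <= a by have := hv 1 0; lra.
have c0 : 0 <= c by have := hv 0 1; lra.
split=> //.
have [a_eq0|a_neq0] := eqVneq a 0; last first.
  have a_gt0 : 0 < a by rewrite lt0r a_neq0.
  (* At (- b, a) the form takes the value a (a c - b^2). *)
  by rewrite -subr_ge0 -(pmulr_rge0 _ a_gt0); have := hv (- b) a; lra.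
(* With a = 0, this vector gives - b^2 (c + 2) >= 0. *)
have := hv (- (c + 1)) b; have := mulr_ge0 c0 (sqr_ge0 b).
by rewrite a_eq0 mul0r; have := sqr_ge0 b; lra.
Qed.

Definition sym2_of (W : lmodType R) (t : rsoc_form W) (w : W) :
    subvs_of (sym_mx R 2) :=
  vsproj (sym_mx R 2) (sym2 (t.1.1 w) (t.1.2 w) (t.2 w)).

Lemma sym2_of_linear (W : lmodType R) (t : rsoc_form W) : linear (sym2_of t).
Proof.
move=> k u v; rewrite /sym2_of -linearP; congr vsproj.
by apply/matrixP=> i j; rewrite !mxE; case: ifP => _; [|case: ifP => _];
  rewrite linearP.
Qed.

HB.instance Definition _ (W : lmodType R) (t : rsoc_form W) :=
  GRing.isLinear.Build R W (subvs_of (sym_mx R 2)) *:%R (sym2_of t)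
    (sym2_of_linear t).

Lemma vsval_sym2_of (W : lmodType R) (t : rsoc_form W) (w : W) :
  vsval (sym2_of t w) = sym2 (t.1.1 w) (t.1.2 w) (t.2 w).
Proof. by rewrite vsprojK // sym2_sym. Qed.

Lemma psd_sym2_of (W : lmodType R) (t : rsoc_form W) (w : W) :
  psd (sym2_of t w) <-> rsoc w t.
Proof.
rewrite (psd_sym2 (vsval_sym2_of t w)) /rsoc.
by split=> [[-> -> ->]|/and3P[]].
Qed.

Definition blocks (W : lmodType R) (s : seq (rsoc_form W)) (w : W) :
    {ffun 'I_(size s) -> subvs_of (sym_mx R 2)} :=
  [ffun i => sym2_of (tnth (in_tuple s) i) w].

Lemma blocks_linear (W : lmodType R) (s : seq (rsoc_form W)) :
  linear (blocks s).
Proof. by move=> k u v; apply/ffunP=> i; rewrite !ffunE linearP. Qed.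

HB.instance Definition _ (W : lmodType R) (s : seq (rsoc_form W)) :=
  GRing.isLinear.Build R W {ffun 'I_(size s) -> subvs_of (sym_mx R 2)} *:%R
    (blocks s) (blocks_linear s).

Lemma psd_pow_blocks (W : lmodType R) (s : seq (rsoc_form W)) (w : W) :
  psd_pow (blocks s w) <-> all (rsoc w) s.
Proof.
split=> [h|/(all_tnthP (t := in_tuple s)) h i]; last first.
  by rewrite ffunE; apply/psd_sym2_of.
apply/(all_tnthP (t := in_tuple s)) => i; apply/psd_sym2_of.
by have := h i; rewrite ffunE.
Qed.

Lemma blocks_eq0 (W : lmodType R) (s : seq (rsoc_form W)) (w : W) (i : nat) t0 :
  blocks s w = 0 -> (i < size s)%N ->
  let t := nth t0 s i in t.1.1 w = 0 /\ t.1.2 w = 0.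
Proof.
move=> h lis t.
have : sym2_of t w = 0.
  by have := congr1 (fun F : {ffun _ -> _} => F (Ordinal lis)) h;
    rewrite !ffunE (tnth_nth t0).
move=> /(congr1 vsval); rewrite vsval_sym2_of raddf0 => /matrixP hM.
by have := hM 0 0; have := hM 0 1; rewrite !mxE /=.
Qed.

(** The projection of the lift must be defined on the matrices, so the
    variables have to be recovered from the blocks.  To this end each coordinate
    w_i is placed off the diagonal in a further block [[x_i, w_i], [w_i, x_i]],
    where x is a second copy of the variables.  Such a block does not constrain
    w, since x_i = |w_i| is a possible choice, and it makes the map from
    variables to blocks injective. *)
Lemma soc_cone_has_psd_lift (V : lmodType R) (S : set V) :
  soc_cone S -> has_psd_lift S 2.
Proof.
move=> [W [s [pi ->]]].
pose cl (i : 'I_(\dim {:W})) : {scalar W} := coord (vbasis {:W}) i.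
pose ct i : rsoc_form (W * W)%type :=
  (cl i \o @snd W W : {scalar _}, cl i \o @fst W W : {scalar _},
   cl i \o @snd W W : {scalar _}).
pose z : rsoc_form (W * W)%type :=
  (\0 : {scalar _}, \0 : {scalar _}, \0 : {scalar _}).
(* The form z only ensures that the number of blocks is positive. *)
pose s' := z :: map (rsoc_pull (@fst W W)) s ++ map ct (enum 'I_(\dim {:W})).
have s'E w x : all (rsoc (w, x)) s' =
    all (rsoc w) s && [forall i, rsoc (w, x) (ct i)].
  rewrite /= all_cat all_rsoc_pull all_map.
  rewrite [rsoc _ z]/rsoc /= lexx expr2 mul0r lexx /=; congr (_ && _).
  by apply/allP/forallP => /= h i; rewrite ?h ?mem_enum // => _; exact: h.
split=> //; exists (size s') => //.
pose E := {ffun 'I_(size s') -> subvs_of (sym_mx R 2)}.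
pose Phi : 'Hom((W * W)%type, E) := linfun (blocks s').
have PhiE w : Phi w = blocks s' w by rewrite lfunE.
have kerPhi : lker Phi == 0%VS.
  apply/lker0P => u v uv.
  have h : blocks s' (u - v) = 0 by rewrite -PhiE linearB /= uv subrr.
  apply/eqP; rewrite -subr_eq0; apply/eqP; move: (u - v) h => -[w x] h.
  have hi i : cl i x = 0 /\ cl i w = 0.
    pose j := (1 + (size s + i))%N.
    have js : (j < size s')%N.
      rewrite /= size_cat !size_map -enumT size_enum_ord.
      by rewrite ltnS ltn_add2l ltn_ord.
    have := blocks_eq0 z h js.
    rewrite /= nth_cat size_map ltnNge leq_addr add0n addKn.
    by rewrite (nth_map i) ?size_enum_ord ?ltn_ord //= nth_ord_enum.
  have vec0 y : (forall i, cl i y = 0) -> y = 0.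
    move=> hy; rewrite (coord_vbasis (memvf y)) big1 // => i _.
    by have := hy i; rewrite /cl /= => ->; rewrite scale0r.
  have -> : w = 0 by apply: vec0 => i; case: (hi i).
  have -> : x = 0 by apply: vec0 => i; case: (hi i).
  reflexivity.
exists [set e | e \in limg Phi], (pi \o @fst W W \o (Phi^-1)%VF); split.
  exists 0, (limg Phi); apply/seteqP; split=> e /=.
    by move=> he; exists e; rewrite ?add0r.
  by case=> u hu <-; rewrite add0r.
apply/seteqP; split=> f /=.
  case=> w sw <-.
  pose x := \sum_i `|cl i w| *: (vbasis {:W})`_i.
  have xE i : cl i x = `|cl i w|.
    by rewrite /cl /x /= coord_sum_free // (basis_free (vbasisP _)).
  exists (Phi (w, x)); last by rewrite lker0_lfunK.
  split; last by rewrite memv_img // memvf.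
  rewrite PhiE; apply/(psd_pow_blocks s' _); rewrite s'E sw; apply/forallP => i.
  by rewrite /rsoc /= !xE normr_ge0 -expr2 real_normK ?num_real // lexx.
case=> e [he /memv_imgP[[w x] _ eE]] <-.
exists w; last by rewrite eE lker0_lfunK.
by move: he; rewrite eE PhiE => /(psd_pow_blocks s' _); rewrite s'E => /andP[].
Qed.

Lemma sxdeg_eq2 (V : lmodType R) (S : set V) :
  has_psd_lift S 2 -> ~ has_psd_lift S 1 -> sxdeg S = 2%N%:E.
Proof.
move=> h2 h1; rewrite /sxdeg; case: pselect => [hS|[]]; last first.
  by exists 2%N; apply/asboolP.
case: ex_minnP => m /asboolP hm /(_ 2%N); rewrite asboolT // => /(_ isT).
case: m hm => [[] //|[|[|m]]] //.
Qed.

End PsdLift.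

(** * Linear algebra of a circuit *)

Section Circuit.
Variables (R : realType) (n k : nat).
Variables (A : set 'X_{1..n}) (alpha : 'I_k.+1 -> 'X_{1..n}) (beta : 'X_{1..n}).
Hypothesis circA : is_circuit R A alpha beta.

Let pt := @mnm_point R n.

Let diffs : 'M[R]_(k, n) :=
  \matrix_(i < k) (pt (alpha (lift ord0 i)) - pt (alpha ord0)).

Lemma circuit_diffs_row_free : row_free diffs.
Proof.
case: circA => _ _ _ + _; rewrite /affinely_independent.
set X := [seq _ | i : _] => freeX.
have XE : X = [tuple row i diffs | i < k].
  by rewrite /X /image_mem; apply: eq_map => i; rewrite rowK.
apply: inj_row_free => v; rewrite mulmx_sum_row => v0.
rewrite XE in freeX; move/freeP: freeX => /(_ (fun i => v 0 i)) h.
apply/rowP => i; rewrite mxE; apply: h; rewrite -[RHS]v0.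
by apply: eq_bigr => j _; rewrite -tnth_nth tnth_mktuple.
Qed.

Lemma circuit_indep (mu : 'I_k.+1 -> R) :
  \sum_i mu i = 0 -> (forall j, \sum_i mu i * (alpha i j)%:R = 0) ->
  forall i, mu i = 0.
Proof.
move=> sum0 comb0.
have head : mu ord0 = - \sum_(i < k) mu (lift ord0 i).
  by apply/eqP; rewrite -addr_eq0 -[X in _ == X]sum0 big_ord_recl.
pose v : 'rV[R]_k := \row_i mu (lift ord0 i).
have v0 : v = 0.
  apply: (row_free_inj circuit_diffs_row_free); rewrite mul0mx.
  apply/rowP => j; rewrite !mxE -[RHS](comb0 j) big_ord_recl head.
  rewrite mulNr mulr_suml addrC -sumrB; apply: eq_bigr => i _.
  by rewrite !mxE mulrBr.
have tail i : mu (lift ord0 i) = 0 by have /rowP/(_ i) := v0; rewrite !mxE.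
move=> i; have [j ->|->] := unliftP ord0 i; first exact: tail.
by rewrite head big1 ?oppr0 // => j _; exact: tail.
Qed.

(** In logarithmic coordinates this prescribes the values of the monomials
    alpha i up to a common factor, which is possible because the differences of
    the alpha i are linearly independent. *)
Lemma circuit_solve (r : 'I_k.+1 -> R) :
  exists (y : 'I_n -> R) (s : R),
    forall i, \sum_j y j * (alpha i j)%:R = s + r i.
Proof.
have /row_freeP[B diffsB] := circuit_diffs_row_free.
pose dr : 'cV[R]_k := \col_i (r (lift ord0 i) - r ord0).
pose y := B *m dr.
have yE i : \sum_j y j 0 * ((alpha (lift ord0 i) j)%:R - (alpha ord0 j)%:R)
    = r (lift ord0 i) - r ord0.
  have := congr1 (fun M : 'cV_k => M i 0) (mulmxA diffs B dr).
  rewrite diffsB mul1mx [in RHS]mxE => <-; rewrite mxE.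
  by apply: eq_bigr => j _; rewrite !mxE mulrC.
exists (fun j => y j 0), (\sum_j y j 0 * (alpha ord0 j)%:R - r ord0) => i.
have [i' ->|->] := unliftP ord0 i; last by rewrite subrK.
have := yE i'; under eq_bigr do rewrite mulrBr.
by rewrite sumrB; lra.
Qed.

Lemma circuit_beta_weights : exists lam : 'I_k.+1 -> R,
  [/\ forall i, 0 < lam i, \sum_i lam i = 1 &
      forall j, (beta j)%:R = \sum_i lam i * (alpha i j)%:R].
Proof.
case: circA => _ _ _ _ [lam [lam0 lam1 /rowP hb]]; exists lam; split=> // j.
by have := hb j; rewrite !mxE summxE => ->; apply: eq_bigr => i _; rewrite !mxE.
Qed.

Lemma circuit_alpha_inj : injective alpha.
Proof.
move=> i i' e; apply/eqP/negPn/negP => ii'.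
pose mu l : R := (l == i)%:R - (l == i')%:R.
have sumE (F : 'I_k.+1 -> R) : \sum_l mu l * F l = F i - F i'.
  rewrite /mu; under eq_bigr do rewrite mulrBl.
  rewrite sumrB (bigD1 i) //= (bigD1 (P := predT) i') //= !eqxx !mul1r.
  rewrite !big1 ?addr0 // => l /negPf ->; exact: mul0r.
suff : mu i = 0 by move/eqP; rewrite /mu eqxx (negPf ii') subr0 oner_eq0.
apply: circuit_indep => [|j]; last by rewrite sumE e subrr.
by have := sumE (fun=> 1); under eq_bigr do rewrite mulr1; rewrite subrr.
Qed.

Lemma circuit_beta_notin i : alpha i != beta.
Proof.
apply/negP => /eqP ai; have [lam [lam0 lam1 lamb]] := circuit_beta_weights.
pose mu l : R := lam l - (l == i)%:R.
have sumE (F : 'I_k.+1 -> R) : \sum_l mu l * F l = \sum_l lam l * F l - F i.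
  rewrite /mu; under eq_bigr do rewrite mulrBl.
  rewrite sumrB [X in _ - X](bigD1 i) //= eqxx mul1r.
  rewrite [X in _ - (_ + X)]big1 ?addr0 // => l /negPf ->; exact: mul0r.
have mu0 : forall l, mu l = 0.
  apply: circuit_indep => [|j]; last by rewrite sumE ai lamb subrr.
  have := sumE (fun=> 1); under eq_bigr do rewrite mulr1.
  by move=> ->; under eq_bigr do rewrite mulr1; rewrite lam1 subrr.
have [i' ii'] : exists i', i' != i.
  case: circA => _ /andP[k0 _] _ _ _.
  have [j ->|->] := unliftP ord0 i; first by exists ord0.
  by exists (lift ord0 (Ordinal k0)).
have := mu0 i'; have := lam0 i'.
by rewrite /mu (negPf ii') subr0 => /lt0r_neq0/eqP.
Qed.

(** The barycentric coordinates of beta solve a linear system with integer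
    entries.  Solvability does not depend on the field, so there is a rational
    solution, and uniqueness over the reals makes it equal to the given positive
    one. *)
Lemma circuit_nat_weights : exists p : 'I_k.+1 -> nat,
  (forall i, 0 < p i)%N /\
  forall j, ((\sum_i p i) * beta j = \sum_i p i * alpha i j)%N.
Proof.
have [lam [lam0 lam1 lamb]] := circuit_beta_weights.
(* The column of ones encodes that the coordinates sum to 1. *)
pose P : 'M[rat]_(k.+1, n + 1) :=
  row_mx (\matrix_(i, j) (alpha i j)%:R) (const_mx 1).
pose b : 'rV[rat]_(n + 1) := row_mx (\row_j (beta j)%:R) (const_mx 1).
have combE (F : fieldType) (mu : 'I_k.+1 -> F) :
    row_mx (\row_j (beta j)%:R) (const_mx 1) = (\row_i mu i) *m
      row_mx (\matrix_(i, j) (alpha i j)%:R) (const_mx 1) :> 'rV_(n + 1) <->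
    \sum_i mu i = 1 /\ forall j, (beta j)%:R = \sum_i mu i * (alpha i j)%:R.
  rewrite mul_mx_row; split=> [/eq_row_mx[/rowP h1 /rowP h2]|[h1 h2]].
    split=> [|j].
      have := h2 0; rewrite !mxE => ->.
      by apply: eq_bigr => i _; rewrite !mxE mulr1.
    by have := h1 j; rewrite !mxE => ->; apply: eq_bigr => i _; rewrite !mxE.
  congr row_mx; apply/rowP => j; rewrite !mxE.
    by rewrite h2; apply: eq_bigr => i _; rewrite !mxE.
  by rewrite -[LHS]h1; apply: eq_bigr => i _; rewrite !mxE mulr1.
have mapE m (M : 'I_m -> 'I_n -> nat) :
    map_mx (ratr : rat -> R) (row_mx (\matrix_(i, j) (M i j)%:R) (const_mx 1))
    = row_mx (\matrix_(i, j) (M i j)%:R) (const_mx 1) :> 'M_(m, n + 1).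
  rewrite map_row_mx map_const_mx rmorph1; congr row_mx.
  by apply/matrixP => i j; rewrite !mxE ratr_nat.
have bE : b = row_mx (\matrix_(i, j) (beta j)%:R) (const_mx 1) by [].
have : (b <= P)%MS.
  rewrite -(map_submx (ratr : {rmorphism rat -> R})) bE !mapE.
  apply/submxP; exists (\row_i lam i); exact/combE.
case/submxP => mu; rewrite (_ : mu = \row_i mu 0 i); last first.
  by apply/rowP => i; rewrite mxE.
move: (fun i => mu 0 i) => {}mu /combE[mu1 mub].
have muE i : ratr (mu i) = lam i.
  apply/eqP; rewrite -subr_eq0; apply/eqP.
  apply: (circuit_indep (mu := fun i => ratr (mu i) - lam i)) => [|j].
    by rewrite sumrB lam1 -rmorph_sum mu1 rmorph1 subrr.
  under eq_bigr do rewrite mulrBl; rewrite sumrB -lamb.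
  apply/eqP; rewrite subr_eq0; apply/eqP.
  rewrite -[RHS](ratr_nat R) mub rmorph_sum; apply: eq_bigr => i' _.
  by rewrite rmorphM /= ratr_nat.
have mu0 i : 0 < mu i by rewrite -(ltr0q R) muE.
(* p i is mu i times the common denominator q of all the mu l. *)
pose p i := (`|numq (mu i)| * \prod_(l | l != i) `|denq (mu l)|)%N.
pose q := (\prod_l `|denq (mu l)|)%N.
have dE l : (`|denq (mu l)|%:R : rat) = (denq (mu l))%:~R.
  by rewrite -[in RHS](absz_denq (mu l)).
have pE i : ((p i)%:R : rat) = mu i * q%:R.
  rewrite /p /q [X in _ = _ * X%:R](bigD1 i) //= !natrM mulrA dE; congr (_ * _).
  rewrite -[X in _ = X * _](divq_num_den (mu i)) divfK ?intr_eq0 ?denq_neq0 //.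
  by rewrite -[in RHS](gez0_abs (_ : 0 <= numq (mu i))) // ltW // numq_gt0.
have qE : q = (\sum_i p i)%N.
  apply/eqP; rewrite -(eqr_nat rat) natr_sum; under eq_bigr do rewrite pE.
  by rewrite -mulr_suml mu1 mul1r.
exists p; split=> [i|j].
  rewrite -(ltr_nat rat) pE mulr_gt0 // ltr0n prodn_gt0 // => l.
  by rewrite absz_gt0 denq_neq0.
apply/eqP; rewrite -qE -(eqr_nat rat) natrM natr_sum mub mulr_sumr.
by apply/eqP/eq_bigr => i _; rewrite natrM pE; ring.
Qed.

End Circuit.

(** * Nonnegativity of polynomials supported on a circuit *)

Section CircuitNumber.
Variable R : realType.

(** The unweighted inequality, for [p i] copies of [q / p i * z i]. *)
Lemma weighted_AGM (I : finType) (p : I -> nat) (z : I -> R) :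
    (forall i, 0 < p i)%N -> (forall i, 0 <= z i) ->
  \prod_i ((\sum_i p i)%:R / (p i)%:R * z i) ^+ p i
    <= (\sum_i z i) ^+ (\sum_i p i).
Proof.
set q := (\sum_i p i)%N => p0 z0.
pose J : finType := {i : I & 'I_(p i)}.
pose E (j : J) : R := q%:R / (p (tag j))%:R * z (tag j).
have cardJ : #|(predT : {pred J})| = q.
  rewrite (card_tagged (fun i => 'I_(p i))) sumnE big_map big_enum.
  by apply: eq_bigr => i _; rewrite card_ord.
have E0 : {in (predT : {pred J}), forall j, 0 <= E j}.
  by move=> j _; rewrite /E mulr_ge0 // divr_ge0 // ler0n.
have := (leif_AGM E0).1; rewrite cardJ => AGM.
have <- : \prod_(j : J) E j = \prod_i (q%:R / (p i)%:R * z i) ^+ p i.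
  rewrite -(sig_big_dep xpredT (fun _ => xpredT)
    (fun i (_ : 'I_(p i)) => q%:R / (p i)%:R * z i)).
  by apply: eq_bigr => i _; rewrite prodr_const card_ord.
apply: le_trans AGM _.
have -> : \sum_(j : J) E j = q%:R * \sum_i z i.
  rewrite -(sig_big_dep xpredT (fun _ => xpredT)
    (fun i (_ : 'I_(p i)) => q%:R / (p i)%:R * z i)) mulr_sumr.
  apply: eq_bigr => i _; rewrite sumr_const card_ord -[LHS]mulr_natr mulrAC.
  by rewrite divfK // pnatr_eq0 -lt0n.
have [->|q0] := eqVneq q 0%N; first by rewrite !expr0.
by rewrite mulrAC divff ?mul1r // pnatr_eq0.
Qed.

Definition wcoord m (a : R) (i : 'I_m) (v : 'rV[R]_m) : R := a * v 0 i.

Lemma wcoord_scalar m a (i : 'I_m) : scalar (wcoord a i).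
Proof. by move=> k u v; rewrite /wcoord !mxE; ring. Qed.

HB.instance Definition _ m a (i : 'I_m) :=
  GRing.isLinear.Build R 'rV[R]_m R *%R (wcoord a i) (wcoord_scalar a i).

Lemma all_flatten_nseq (I T : Type) (P : pred T) (p : I -> nat) (f : I -> T)
    (s : seq I) :
  all P (flatten [seq nseq (p i) (f i) | i <- s])
  = all (fun i => (p i == 0)%N || P (f i)) s.
Proof. by elim: s => //= i s IH; rewrite all_cat all_nseq IH. Qed.

(** When [p i / q] are the barycentric coordinates of the inner exponent, the
    q-th root of the right-hand side is the circuit number of the coefficients
    [v.1]. *)
Definition circuit_number_cone m (p : 'I_m -> nat) :
    set ('rV[R]_m * R^o)%type :=
  [set v : ('rV[R]_m * R^o)%type |
    (forall i, 0 <= v.1 0 i) /\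
    `|v.2| ^+ (\sum_i p i) <=
      \prod_i ((\sum_i p i)%:R / (p i)%:R * v.1 0 i) ^+ p i].

Lemma soc_rep_circuit_number_cone m (p : 'I_m -> nat) :
  (forall i, 0 < p i)%N -> soc_rep (circuit_number_cone p).
Proof.
move=> p0; set q := (\sum_i p i)%N.
pose V := ('rV[R]_m * R^o)%type.
pose w i : {scalar (V * R^o)%type} :=
  @wcoord m (q%:R / (p i)%:R) i \o @fst 'rV[R]_m R^o \o @fst V R^o.
pose b : {scalar (V * R^o)%type} := @snd 'rV[R]_m R^o \o @fst V R^o.
pose t : {scalar (V * R^o)%type} := @snd V R^o.
pose ls := flatten [seq nseq (p i) (w i) | i <- enum 'I_m].
have szls : size ls = q.
  rewrite size_flatten /shape -map_comp sumnE big_map big_enum.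
  by apply: eq_bigr => i _; rewrite /= size_nseq.
have prE v : \prod_(l <- ls) l v =
    \prod_i (q%:R / (p i)%:R * v.1.1 0 i) ^+ p i.
  rewrite big_flatten big_map big_enum; apply: eq_bigr => i _.
  by rewrite big_nseq iter_mulr mulr1.
have allE v : all (fun l : {scalar (V * R^o)%type} => 0 <= l v) ls <->
    forall i, 0 <= v.1.1 0 i.
  rewrite all_flatten_nseq; split=> [/allP h i|h].
    have := h i; rewrite mem_enum eqn0Ngt p0 /= /wcoord => /(_ isT).
    rewrite pmulr_rge0 // divr_gt0 ?ltr0n // /q (bigD1 i) //=.
    by rewrite ltn_addr.
  apply/allP => i _; rewrite /= /wcoord mulr_ge0 ?orbT // divr_ge0 ?ler0n //.
have := soc_rep_proj (soc_repI (soc_rep_gm t ls)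
  (soc_repI (soc_rep_ge0 (t \- b)) (soc_rep_ge0 (t \+ b)))).
congr soc_rep; apply/seteqP; split=> -[c y] /=.
  case=> x [[x0 /allE c0]]; rewrite szls prE /= => xq [].
  rewrite subr_ge0 => yx xy.
  split=> //=; apply: le_trans xq; rewrite lerXn2r ?nnegrE ?normr_ge0 //.
  by rewrite ler_norml yx andbT -subr_ge0 opprK addrC.
case=> /= c0 yq; exists `|y|; split.
  by split; [exact: normr_ge0|exact/allE|rewrite szls prE].
rewrite /= subr_ge0 ler_norm; split=> //.
by rewrite -[X in _ + X]opprK subr_ge0 -normrN ler_norm.
Qed.

Variables n k : nat.
Variables (alpha : 'I_k.+1 -> 'X_{1..n}) (beta : 'X_{1..n}).
Variable p : 'I_k.+1 -> nat.
Hypothesis p_gt0 : forall i, (0 < p i)%N.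
Hypothesis alpha_even : forall i j, ~~ odd (alpha i j).
Let q := (\sum_i p i)%N.
Hypothesis p_beta : forall j, (q * beta j = \sum_i p i * alpha i j)%N.

Definition circuit_poly (v : ('rV[R]_k.+1 * R^o)%type) : {mpoly R[n]} :=
  \sum_i v.1 0 i *: 'X_[alpha i] + v.2 *: 'X_[beta].

Lemma circuit_poly_linear : linear circuit_poly.
Proof.
move=> a u v; rewrite /circuit_poly /= scalerDr addrACA scaler_sumr -big_split.
congr (_ + _); last by rewrite scalerDl scalerA.
by apply: eq_bigr => i _; rewrite !mxE scalerDl scalerA.
Qed.

HB.instance Definition _ :=
  GRing.isLinear.Build R ('rV[R]_k.+1 * R^o)%type {mpoly R[n]} *:%R
    circuit_poly circuit_poly_linear.

Definition mnm_eval (x : 'I_n -> R) (m : 'X_{1..n}) : R :=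
  \prod_j x j ^+ m j.

Lemma meval_circuit_poly v x : (circuit_poly v).@[x] =
  \sum_i v.1 0 i * mnm_eval x (alpha i) + v.2 * mnm_eval x beta.
Proof.
rewrite mevalD mevalZ mevalX raddf_sum /=; congr (_ + _).
by apply: eq_bigr => i _; rewrite mevalZ mevalX.
Qed.

Lemma mnm_eval_even_ge0 x (m : 'X_{1..n}) :
  (forall j, ~~ odd (m j)) -> 0 <= mnm_eval x m.
Proof. by move=> em; apply: prodr_ge0 => j _; rewrite exprn_even_ge0. Qed.

Lemma mnm_eval_beta x :
  mnm_eval x beta ^+ q = \prod_i mnm_eval x (alpha i) ^+ p i.
Proof.
rewrite /mnm_eval -prodrXl; under [RHS]eq_bigr do rewrite -prodrXl.
rewrite exchange_big; apply: eq_bigr => j _ /=.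
under eq_bigr do rewrite -exprM mulnC.
by rewrite -expr_sum -p_beta -exprM mulnC.
Qed.

Lemma q_gt0 : (0 < q)%N.
Proof. by rewrite /q (bigD1 ord0) //= ltn_addr. Qed.

(** At every point the term of beta is, up to sign, at most the weighted
    geometric mean of the terms of the alpha i, hence at most their sum. *)
Lemma circuit_poly_nonneg v :
  circuit_number_cone p v -> mpoly_nonneg (circuit_poly v).
Proof.
case: v => c b [/= c0 bq] x; rewrite meval_circuit_poly /=.
have m0 i : 0 <= mnm_eval x (alpha i) by exact: mnm_eval_even_ge0.
have z0 i : 0 <= c 0 i * mnm_eval x (alpha i) by rewrite mulr_ge0.
have S0 := sumr_ge0 _ (fun i (_ : predT i) => z0 i).
suff : `|b * mnm_eval x beta| <= \sum_i c 0 i * mnm_eval x (alpha i).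
  by rewrite ler_norml => /andP[h _]; rewrite -[X in _ + X]opprK subr_ge0 lerNl.
rewrite -(ler_pXn2r q_gt0) ?nnegrE ?normr_ge0 //.
apply: le_trans (weighted_AGM p_gt0 z0).
rewrite normrM exprMn -[X in _ * X]normrX mnm_eval_beta.
rewrite [X in _ * X]ger0_norm; last first.
  by apply: prodr_ge0 => i _; rewrite exprn_ge0.
apply: le_trans (ler_wpM2r _ bq) _.
  by apply: prodr_ge0 => i _; rewrite exprn_ge0.
by rewrite -big_split /= le_eqVlt; apply/orP; left; apply/eqP;
  apply: eq_bigr => i _; rewrite -exprMn mulrA.
Qed.

Lemma mnm_eval_exp (s y : 'I_n -> R) m :
  mnm_eval (fun j => s j * sequences.expR (y j)) m =
  mnm_eval s m * sequences.expR (\sum_j y j * (m j)%:R).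
Proof.
rewrite exp.expR_sum /mnm_eval -big_split; apply: eq_bigr => j _ /=.
by rewrite exprMn exp.expRM_natr.
Qed.

Hypothesis solvable : forall r : 'I_k.+1 -> R,
  exists (y : 'I_n -> R) (s : R),
    forall i, \sum_j y j * (alpha i j)%:R = s + r i.

(** Nonnegativity is tested at the positive point where the terms of the alpha i
    are proportional to the weights, with signs for its coordinates that make
    the term of beta minus its absolute value.  The weighted inequality of means
    is an equality there, and the bound results.  Such signs can fail to exist
    only when the coefficient of beta is nonnegative and its exponents are
    even. *)
Lemma circuit_poly_nonneg_cone (v : ('rV[R]_k.+1 * R^o)%type) :
    (forall i, 0 < v.1 0 i) -> mpoly_nonneg (circuit_poly v) ->
  circuit_number_cone p v \/ 0 <= v.2 /\ forall j, ~~ odd (beta j).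
Proof.
case: v => c b /= c0 nn.
(* Flipping the sign of one variable with an odd exponent in beta suffices. *)
have [[sgn [sgn_even sgn_b]]|even_b] :
    (exists sgn : 'I_n -> R,
       (forall i, mnm_eval sgn (alpha i) = 1) /\
       b * mnm_eval sgn beta = - `|b|)
    \/ (0 <= b /\ forall j, ~~ odd (beta j)); [|left|by right].
  have [b0|b0] := leP b 0.
    left; exists (fun=> 1); split=> [i|].
      by rewrite /mnm_eval big1 // => j _; rewrite expr1n.
    rewrite /mnm_eval big1 => [|j _]; last by rewrite expr1n.
    by rewrite mulr1 ler0_norm // opprK.
  have [/forallP eb|/forallPn[j]] := boolP [forall j, ~~ odd (beta j)].
    by right; rewrite ltW.
  rewrite negbK => oddj.
  left; exists (fun l => if l == j then -1 else 1).
  have sE m : mnm_eval (fun l => if l == j then -1 else 1) m = (-1) ^+ m j :> R.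
    rewrite /mnm_eval (bigD1 j) //= eqxx big1 ?mulr1 // => l /negPf ->.
    exact: expr1n.
  split=> [i|]; rewrite sE -signr_odd ?oddj ?(negPf (alpha_even i j)) //.
  by rewrite expr1 mulrN1 gtr0_norm.
split=> [i|/=]; first exact: ltW.
have p0R i : 0 < (p i)%:R :> R by rewrite ltr0n.
have [y [s ys]] := solvable (fun i => exp.ln ((p i)%:R / c 0 i)).
have monE i : sequences.expR (\sum_j y j * (alpha i j)%:R)
    = sequences.expR s * ((p i)%:R / c 0 i).
  by rewrite ys exp.expRD exp.lnK // posrE divr_gt0.
have := nn (fun j => sgn j * sequences.expR (y j)).
rewrite meval_circuit_poly /= mnm_eval_exp mulrA sgn_b.
set M := sequences.expR (\sum_j y j * (beta j)%:R).
have M0 : 0 < M := exp.expR_gt0 _.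
have -> : \sum_i c 0 i *
      mnm_eval (fun j => sgn j * sequences.expR (y j)) (alpha i) =
    q%:R * sequences.expR s.
  rewrite /q natr_sum mulr_suml; apply: eq_bigr => i _.
  rewrite mnm_eval_exp sgn_even mul1r monE mulrCA mulrC; congr (_ * _).
  by rewrite mulrC divfK // gt_eqF.
rewrite mulNr subr_ge0 => le_bM.
(* mnm_eval_beta at the positive point, written as 1 * expR (y j) to match
   mnm_eval_exp *)
have Mq : M ^+ q = \prod_i (sequences.expR s * ((p i)%:R / c 0 i)) ^+ p i.
  have := mnm_eval_beta (fun j => 1 * sequences.expR (y j)).
  have one m : mnm_eval (fun=> 1) m = 1.
    by rewrite /mnm_eval big1 // => j _; rewrite expr1n.
  rewrite (mnm_eval_exp (fun=> 1)) one mul1r => ->.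
  by apply: eq_bigr => i _; rewrite (mnm_eval_exp (fun=> 1)) one mul1r monE.
rewrite -(ler_pM2r (exprn_gt0 q M0)) -exprMn.
rewrite [X in _ <= _ * X]Mq -big_split /=.
rewrite (_ : \prod_i _ = (q%:R * sequences.expR s) ^+ q).
  rewrite lerXn2r ?nnegrE ?mulr_ge0 ?normr_ge0 ?ler0n ?(ltW M0) //.
  exact/ltW/exp.expR_gt0.
rewrite [in RHS]/q expr_sum; apply: eq_bigr => i _; rewrite -exprMn.
congr (_ ^+ _); rewrite -[in LHS]/q.
have := p0R i; have := c0 i => ci pi.
by field; rewrite !gt_eqF.
Qed.

End CircuitNumber.

(** * The SONC cone as a finite sum of second-order cones *)

Section SoncLift.
Variables (R : realType) (n : nat).

Section CircuitPolynomials.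
Variables (k : nat) (A : set 'X_{1..n}).
Variables (alpha : 'I_k.+1 -> 'X_{1..n}) (beta : 'X_{1..n}).
Hypothesis circA : is_circuit R A alpha beta.

Lemma circuit_poly_coef_alpha v i :
  (circuit_poly (R := R) alpha beta v)@_(alpha i) = v.1 0 i.
Proof.
rewrite /circuit_poly mcoeffD mcoeffZ mcoeffX raddf_sum /=.
rewrite eq_sym (negPf (circuit_beta_notin circA i)) mulr0 addr0.
rewrite (bigD1 i) //= mcoeffZ mcoeffX eqxx mulr1 big1 ?addr0 // => j ji.
by rewrite mcoeffZ mcoeffX (inj_eq (circuit_alpha_inj circA)) (negPf ji) mulr0.
Qed.

Lemma circuit_poly_coef_beta v :
  (circuit_poly (R := R) alpha beta v)@_beta = v.2.
Proof.
rewrite /circuit_poly mcoeffD mcoeffZ mcoeffX raddf_sum /= eqxx mulr1.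
rewrite big1 ?add0r // => j _.
by rewrite mcoeffZ mcoeffX (negPf (circuit_beta_notin circA j)) mulr0.
Qed.

Lemma circuit_poly_nonneg_circuit (v : ('rV[R]_k.+1 * R^o)%type) :
    (forall i, 0 < v.1 0 i) ->
    mpoly_nonneg (circuit_poly (R := R) alpha beta v) ->
  nonneg_circuit_polys A (circuit_poly alpha beta v).
Proof.
move=> v0 nn; exists k, alpha, beta; split=> // [|i].
  rewrite [LHS]/circuit_poly circuit_poly_coef_beta; congr (_ + _).
  by apply: eq_bigr => i _; rewrite circuit_poly_coef_alpha.
by rewrite circuit_poly_coef_alpha.
Qed.

Lemma msize_circuit_poly d v :
    (forall a, A a -> (mdeg a <= d)%N) ->
  (msize (circuit_poly (R := R) alpha beta v) <= d.+1)%N.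
Proof.
case: circA => AE _ _ _ _ degA.
have sz c a : A a -> (msize (c *: 'X_[a] : {mpoly R[n]}) <= d.+1)%N.
  by move=> Aa; apply: leq_trans (msizeZ_le _ _) _; rewrite msizeX ltnS degA.
apply: leq_trans (msizeD_le _ _) _; rewrite geq_max.
rewrite sz ?andbT; last by rewrite AE; right.
apply: leq_trans (msize_sum _ _ _) _; apply/bigmax_leqP => i _.
by apply: sz; rewrite AE; left; exists i.
Qed.

End CircuitPolynomials.

Variable d : nat.
Local Notation C := (SONC R n d).

Definition sonc_generator (g : {mpoly R[n]}) : Prop :=
  (exists2 A, circuits_deg R (2 * d) A & nonneg_circuit_polys A g)
  \/ (exists2 a : 'X_{1..n}, (mdeg a <= d)%N & g = 'X_[a *+ 2]).

Lemma SONC_ray c g : 0 <= c -> (msize g <= (2 * d).+1)%N -> sonc_generator g ->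
  C (c *: g).
Proof.
move=> c0 szg gen; split; first exact: leq_trans (msizeZ_le _ _) szg.
by exists 1%N, (fun=> c), (fun=> g); split=> //; rewrite big_ord1.
Qed.

Lemma even_mnmE (m : 'X_{1..n}) : (forall j, ~~ odd (m j)) ->
  exists a : 'X_{1..n}, m = (a *+ 2)%MM.
Proof.
move=> em; exists [multinom (m j)./2 | j < n]; apply/mnmP => j.
by rewrite mulmnE mnmE muln2 even_halfK.
Qed.

Lemma SONC_even_mnm c (m : 'X_{1..n}) : 0 <= c -> (forall j, ~~ odd (m j)) ->
  (mdeg m <= 2 * d)%N -> C (c *: 'X_[m]).
Proof.
move=> c0 /even_mnmE[a ->] dm; apply: SONC_ray; rewrite ?msizeX //.
by right; exists a => //; move: dm; rewrite mdegMn mulnC leq_pmul2l.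
Qed.

Lemma SONC0 : C 0.
Proof.
rewrite -(scale0r 'X_[0%MM]); apply: SONC_even_mnm => //.
  by move=> j; rewrite mnm0E.
by rewrite mdeg0.
Qed.

Lemma SONCD f g : C f -> C g -> C (f + g).
Proof.
move=> [szf [N [mu [F [N0 mu0 genF fE]]]]] [szg [M [nu [G [M0 nu0 genG gE]]]]].
split; first by apply: leq_trans (msizeD_le _ _) _; rewrite geq_max szf.
exists (N + M)%N,
  (fun i => match split i with inl j => mu j | inr j => nu j end),
  (fun i => match split i with inl j => F j | inr j => G j end).
split=> [|i|i|]; first by rewrite ltn_addr.
- by case: split.
- by case: split.
rewrite fE gE big_split_ord; congr (_ + _); apply: eq_bigr => i _.
  by rewrite -[lshift _ _]/(unsplit (inl i)) unsplitK.
by rewrite -[rshift _ _]/(unsplit (inr i)) unsplitK.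
Qed.

Lemma SONC_nonneg f : C f -> mpoly_nonneg f.
Proof.
case=> _ [N [mu [g [_ mu0 gen ->]]]] x; rewrite raddf_sum /= sumr_ge0 // => i _.
rewrite mevalZ mulr_ge0 //.
case: (gen i) => [[A _ [k [al [be [_ _ nn _]]]]]|[a _ ->]].
  exact: nn.
rewrite mevalX; apply: mnm_eval_even_ge0 => j.
by rewrite mulmnE muln2 odd_double.
Qed.

(** Stated for every exponent, so that the inner exponent of a circuit can be
    treated without distinguishing whether it is even. *)
Lemma soc_cone_even_ray (m : 'X_{1..n}) : (mdeg m <= 2 * d)%N ->
  exists T : set {mpoly R[n]}, [/\ soc_cone T,
    (forall j, ~~ odd (m j)) -> forall c, 0 <= c -> T (c *: 'X_[m]) & T `<=` C].
Proof.
move=> dm; have [em|Nem] := pselect (forall j, ~~ odd (m j)).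
  exists [set c *: 'X_[m] | c in [set c | 0 <= c]]; split.
  - exact: soc_cone_ray.
  - by move=> _ c c0; exists c.
  - by move=> _ [c /= c0 <-]; apply: SONC_even_mnm.
exists [set 0]; split=> //; first exact: soc_cone_set0.
by move=> _ ->; exact: SONC0.
Qed.

(** The piece of the SONC cone that belongs to one circuit: coefficient vectors
    below the circuit number, plus the ray of the monomial beta when that is a
    square.  Where the coefficient of some alpha i vanishes, so does that of
    beta, and what remains is a sum of monomial squares; this is why the closed
    piece stays in the SONC cone although nonnegative circuit polynomials are
    required to have positive coefficients. *)
Lemma circuit_soc_cone k (A : set 'X_{1..n}) (alpha : 'I_k.+1 -> 'X_{1..n})
    (beta : 'X_{1..n}) :
  is_circuit R A alpha beta -> (forall a, A a -> (mdeg a <= 2 * d)%N) ->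
  exists T : set {mpoly R[n]}, [/\ soc_cone T,
    forall v : ('rV[R]_k.+1 * R^o)%type, (forall i, 0 < v.1 0 i) ->
      mpoly_nonneg (circuit_poly alpha beta v) ->
      T (circuit_poly alpha beta v) &
    T `<=` C].
Proof.
move=> circA degA.
have [AE _ alpha_even _ _] := circA.
have [p [p0 pb]] := circuit_nat_weights circA.
have degb : (mdeg beta <= 2 * d)%N by apply: degA; rewrite AE; right.
have dega i : (mdeg (alpha i) <= 2 * d)%N.
  by apply: degA; rewrite AE; left; exists i.
have [Q [socQ Qray QC]] := soc_cone_even_ray degb.
pose P := circuit_poly alpha beta @` circuit_number_cone (R := R) p.
have socP : soc_cone P.
  exact: (soc_rep_image (circuit_poly alpha beta)
    (soc_rep_circuit_number_cone _ p0)).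
exists (msum P Q); split; first exact: soc_cone_msum.
  move=> v v0 nn.
  have [vP|[b0 eb]] :=
    circuit_poly_nonneg_cone p0 alpha_even pb (circuit_solve circA) v0 nn.
    exists (circuit_poly alpha beta v); first by exists v.
    by exists 0; rewrite ?addr0 //; exact: soc_cone0.
  exists (circuit_poly alpha beta (v.1, 0)).
    exists (v.1, 0) => //; split=> [i|] /=; first exact: ltW.
    rewrite normr0 expr0n gtn_eqF ?q_gt0 //; apply: prodr_ge0 => i _.
    by rewrite exprn_ge0 // mulr_ge0 ?divr_ge0 ?ler0n // ltW.
  exists (v.2 *: 'X_[beta]); first exact: Qray.
  by rewrite /circuit_poly /= scale0r addr0.
move=> _ [_ [[c b] cb <-] [g Qg <-]]; apply: SONCD; last exact: QC.
have nn := circuit_poly_nonneg p0 alpha_even pb cb.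
have [c0 bq] := cb; rewrite /= in c0 bq.
have [/forallP cpos|/forallPn[i ci]] := boolP [forall i, 0 < c 0 i].
  rewrite -[circuit_poly _ _ _]scale1r; apply: SONC_ray => //.
    exact: (msize_circuit_poly circA _ degA).
  left; exists A; last exact: circuit_poly_nonneg_circuit.
  by split=> //; exists k, alpha, beta.
have ci0 : c 0 i = 0 by apply/eqP; rewrite eq_le c0 andbT leNgt.
have b0 : b = 0.
  move: bq; rewrite [leRHS](bigD1 i) //= ci0 mulr0 expr0n gtn_eqF // mul0r.
  move=> bq.
  have : `|b| ^+ (\sum_i p i) == 0 by rewrite eq_le bq exprn_ge0.
  by rewrite expf_eq0 normr_eq0 => /andP[_ /eqP].
rewrite /circuit_poly /= b0 scale0r addr0.
apply: big_ind => [||j _]; [exact: SONC0|exact: SONCD|exact: SONC_even_mnm].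
Qed.

Lemma soc_cone_SONC : soc_cone C.
Proof.
(* The finitely many candidates (alpha, beta), and the candidate squares. *)
pose B : finType := 'X_{1..n < (2 * d).+1}.
pose I : finType := ({k : 'I_n.+1 & {ffun 'I_k.+1 -> B}} * B + B)%type.
pose G (i : I) : set {mpoly R[n]} := match i with
  | inl (existT k a, b) => [set g | exists A,
      [/\ is_circuit R A (fun i => bmnm (a i)) (bmnm b),
          (forall m, A m -> (mdeg m <= 2 * d)%N) &
          exists2 v : ('rV[R]_k.+1 * R^o)%type,
            (forall i, 0 < v.1 0 i) /\ mpoly_nonneg g &
            g = circuit_poly (fun i => bmnm (a i)) (bmnm b) v]]
  | inr a => [set g | (forall j, ~~ odd (bmnm a j)) /\ g = 'X_[bmnm a]]
  end.
have /choice[T hT] : forall i, exists T : set {mpoly R[n]},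
    [/\ soc_cone T, G i `<=` T & T `<=` C].
  case=> [[[k a] b]|a] /=; last first.
    have [T [socT ray TC]] := soc_cone_even_ray (valP a : mdeg a < _)%N.
    exists T; split=> // g [em ->]; rewrite -['X_[_]]scale1r; exact: ray.
  have [[A [circA degA]]|nocirc] := pselect (exists A,
      is_circuit R A (fun i => bmnm (a i)) (bmnm b) /\
      (forall m, A m -> (mdeg m <= 2 * d)%N)).
    have [T [socT nnT TC]] := circuit_soc_cone circA degA.
    exists T; split=> // g [A' [_ _ [v [v0 nn] gE]]].
    by rewrite gE; apply: nnT; rewrite -?gE.
  exists [set 0]; split; first exact: soc_cone_set0.
    by move=> g [A [circA degA _]]; case: nocirc; exists A.
  by move=> _ ->; exact: SONC0.
apply: (soc_cone_cover SONC0 SONCD hT) => f [_ [N [mu [g [_ mu0 gen fE]]]]].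
exists N, mu, g; split=> // j.
case: (gen j) => [[A [_ degA] [k [al [be [circA gE nn gpos]]]]]|[a da ga]].
  have [AE /andP[_ kn] _ _ _] := circA.
  have da i : (mdeg (al i) < (2 * d).+1)%N.
    by rewrite ltnS; apply: degA; rewrite AE; left; exists i.
  have db : (mdeg be < (2 * d).+1)%N.
    by rewrite ltnS; apply: degA; rewrite AE; right.
  pose k' : 'I_n.+1 := Ordinal (kn : (k < n.+1)%N).
  pose a : {ffun 'I_k'.+1 -> B} := [ffun i => BMultinom (da i)].
  have aE : (fun i => bmnm (a i)) = al by apply/funext => i; rewrite ffunE.
  exists (inl (existT _ k' a, BMultinom db)); exists A; rewrite aE; split=> //.
  exists (\row_i (g j)@_(al i), (g j)@_be).
    by split=> // i; rewrite mxE.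
  rewrite {1}gE /circuit_poly /=; congr (_ + _).
  by apply: eq_bigr => i _; rewrite mxE.
have da2 : (mdeg (a *+ 2) < (2 * d).+1)%N.
  by rewrite ltnS mdegMn mulnC leq_mul2l.
exists (inr (BMultinom da2)); split=> // i.
by rewrite /= mulmnE muln2 odd_double.
Qed.

End SoncLift.

(** * The SONC cone is not the projection of a polyhedron *)

Section NotPolyhedral.
Variable R : realType.

Lemma psd1 (M : subvs_of (sym_mx R 1)) : psd M <-> 0 <= vsval M 0 0.
Proof.
rewrite /psd /=; set B := vsval M.
have qE (x : 'cV[R]_1) : (x^T *m B *m x) 0 0 = B 0 0 * x 0 0 ^+ 2.
  by rewrite !mxE !big_ord1 !mxE !big_ord1 !mxE mulrAC mulrC expr2 mulrA.
split=> [/(_ (const_mx 1))|B0 x]; rewrite qE; last by rewrite mulr_ge0 ?sqr_ge0.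
by rewrite mxE expr1n mulr1.
Qed.

(** The preimages of the [f t] lie in an orthant with finitely many faces, so
    two of them lie in the relative interior of the same face, and the segment
    between them can be prolonged inside this face. *)
Lemma psd1_lift_extends (V : lmodType R) (S : set V) (f : nat -> V) :
    has_psd_lift S 1 -> (forall t, S (f t)) ->
  exists s t, s != t /\
    exists2 eps : R, 0 < eps & S (f t + eps *: (f t - f s)).
Proof.
move=> [_ [m _ [H [pi [[p [U HE]] SE]]]]] Sf.
have /choice[y hy] : forall t, exists y, [/\ psd_pow y, H y & pi y = f t].
  by move=> t; have := Sf t; rewrite SE => -[y [? ?] <-]; exists y.
pose e t i : R := vsval (y t i) 0 0.
have e0 t i : 0 <= e t i by have [h _ _] := hy t; apply/psd1.
pose supp (t : 'I_(2 ^ m).+1) : {set 'I_m} := [set i | e t i != 0]%SET.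
have /injectivePn[s [t st supp_st]] : ~~ injectiveb supp.
  apply/negP => /injectiveP /leq_card.
  by rewrite card_ord -[X in (_ <= X)%N]cardsT -powersetT card_powerset cardsT
    card_ord ltnn.
exists (nat_of_ord s), (nat_of_ord t); split.
  by apply: contraNneq st => /val_inj ->.
(* Where e t i = 0 also e s i = 0, so the conventional value of the quotient
   by zero is harmless. *)
pose K := \sum_i e s i / e t i.
have K0 : 0 <= K by apply: sumr_ge0 => i _; rewrite divr_ge0.
have esK i : e s i <= K * e t i.
  have [et0|et0] := eqVneq (e t i) 0.
    suff -> : e s i = 0 by rewrite mulr_ge0.
    by have /setP/(_ i) := supp_st; rewrite !inE et0 eqxx => /negbFE/eqP.
  rewrite -ler_pdivrMr ?lt0r ?et0 ?e0 // /K (bigD1 i) //= lerDl.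
  by apply: sumr_ge0 => j _; rewrite divr_ge0.
pose eps := (K + 1)^-1.
have K1 : 0 < K + 1 by rewrite ltr_wpDl.
have eps0 : 0 < eps by rewrite invr_gt0.
exists eps => //; rewrite SE.
have [_ Hs <-] := hy s; have [_ Ht <-] := hy t.
exists (y t + eps *: (y t - y s)); last by rewrite linearD linearZ /= linearB.
split=> [i|].
  apply/psd1; rewrite !ffunE linearD linearZ /= linearB /= !mxE.
  rewrite -/(e t i) -/(e s i).
  have h : eps * e s i <= e t i.
    rewrite /eps mulrC ler_pdivrMr //; apply: le_trans (esK i) _.
    by rewrite mulrC ler_wpM2l // lerDl.
  have := mulr_ge0 (ltW eps0) (e0 t i); lra.
move: Hs Ht; rewrite HE => -[us /= Us <-] [ut /= Ut <-].
exists (ut + eps *: (ut - us)); last by rewrite opprD addrACA subrr add0r addrA.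
by rewrite memvD // memvZ // memvB.
Qed.

Variables (n d : nat) (n_gt0 : (0 < n)%N) (d_gt0 : (0 < d)%N).
Let x0 : 'I_n := Ordinal n_gt0.
Let alpha (i : 'I_2) : 'X_{1..n} :=
  if i == ord0 then 0%MM else (U_(x0) *+ 2)%MM.
Let beta : 'X_{1..n} := U_(x0)%MM.

(** The support 1, x_0, x_0^2 of (x_0 - t)^2 for t nonzero. *)
Lemma square_circuit : is_circuit R (range alpha `|` [set beta]) alpha beta.
Proof.
split=> //.
- move=> i j; rewrite /alpha; case: ifP => _; first by rewrite mnm0E.
  by rewrite mulmnE muln2 odd_double.
- rewrite /affinely_independent /image_mem enum_ordSl.
  rewrite (size0nil (size_enum_ord 0)) /= seq1_free; apply/eqP => /rowP/(_ x0).
  rewrite !mxE /alpha /= mulmnE mnm0E mnm1E eqxx subr0 mul1n => /eqP.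
  by rewrite pnatr_eq0.
exists (fun=> 2^-1); split=> [i||]; first by rewrite invr_gt0 ltr0n.
  by rewrite big_ord_recl big_ord1; lra.
apply/rowP => j; rewrite big_ord_recl big_ord1 !mxE /alpha /= mnm0E mulmnE.
by rewrite natrM mulr0 add0r mulrCA mulVf ?mulr1 // pnatr_eq0.
Qed.

Definition shifted_square (t : R) : {mpoly R[n]} :=
  circuit_poly alpha beta
    (\row_(i < 2) (if i == ord0 then t ^+ 2 else 1), - (2 * t)).

Lemma meval_shifted_square t x : (shifted_square t).@[x] = (x x0 - t) ^+ 2.
Proof.
rewrite /shifted_square meval_circuit_poly /= big_ord_recl big_ord1 !mxE /=.
have evalU m : mnm_eval x (U_(x0) *+ m)%MM = x x0 ^+ m.
  rewrite /mnm_eval (bigD1 x0) //= mulmnE mnm1E eqxx mul1n big1 ?mulr1 //.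
  by move=> j jx; rewrite mulmnE mnm1E eq_sym (negPf jx) expr0.
have -> : mnm_eval x (alpha ord0) = 1.
  by rewrite /mnm_eval big1 // => j _; rewrite mnm0E expr0.
rewrite -[beta]mulm1n !evalU; ring.
Qed.

Lemma shifted_square_SONC t : t != 0 -> SONC R n d (shifted_square t).
Proof.
move=> t0.
have degA a : (range alpha `|` [set beta]) a -> (mdeg a <= 2 * d)%N.
  case=> [[i _ <-]|->]; last by rewrite mdeg1 muln_gt0.
  by rewrite /alpha; case: ifP; rewrite ?mdeg0 // mdegMn mdeg1 mul1n leq_pmulr.
rewrite -[shifted_square _]scale1r; apply: SONC_ray => //.
  exact: (msize_circuit_poly square_circuit _ degA).
left; exists (range alpha `|` [set beta]).
  by split=> //; exists 1%N, alpha, beta; exact: square_circuit.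
apply: circuit_poly_nonneg_circuit square_circuit _ _ _ => [i|x].
  by rewrite mxE; case: ifP => // _; rewrite exprn_even_gt0.
by rewrite meval_shifted_square sqr_ge0.
Qed.

Lemma SONC_no_psd1_lift : ~ has_psd_lift (SONC R n d) 1.
Proof.
move=> lift1.
have [t|s [t [st [eps eps0]]]] :=
    psd1_lift_extends (f := fun t => shifted_square t.+1%:R) lift1.
  by apply: shifted_square_SONC; rewrite pnatr_eq0.
move=> /SONC_nonneg/(_ (fun=> t.+1%:R)).
rewrite mevalD mevalZ mevalB !meval_shifted_square subrr expr0n add0r sub0r.
rewrite mulrN oppr_ge0 leNgt mulr_gt0 // exprn_even_gt0 //=.
by rewrite subr_eq0 eqr_nat eqSS eq_sym.
Qed.

End NotPolyhedral.

Theorem theorem17 (R : realType) (n d : nat) (hn : (0 < n)%N) (hd : (0 < d)%N) :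
  sxdeg (SONC R n d) = 2%N%:E.
Proof.
apply: sxdeg_eq2; last exact: SONC_no_psd1_lift.
exact/soc_cone_has_psd_lift/soc_cone_SONC.
Qed.
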